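(* Let $G$ be a connected quasi-threshold graph. Let $\mathbb Q$ be its set of maximal cliques, $\mathbb S$ its set of minimal vertex separators, and for $Q\in\mathbb Q$ let $\mathrm{Simp}(Q)$ be the set of simplicial vertices of $G$ lying in $Q$. Then the multiset of nonzero Laplacian eigenvalues of $G$ is exactly the multiset union of: (a) $d_G(v)+1$, taken once for each non-simplicial vertex $v$ of $G$; (b) $|Q|$, taken $|\mathrm{Simp}(Q)|-1$ times, for each $Q\in\mathbb Q$; (c) $|S|$, taken $\mu(S)$ times, for each $S\in\mathbb S$.
   Context: All graphs are finite, simple and undirected; $d_G(v)$ is the degree of $v$. The Laplacian matrix is $L(G)=D(G)-A(G)$ (diagonal degree matrix minus adjacency matrix). A graph is quasi-threshold if it contains neither $P_4$ nor $C_4$ as an induced subgraph (such graphs are chordal). A vertex is simplicial if its neighbourhood is a clique. A minimal vertex separator is a set $S$ which, for some non-adjacent $u,v$, separates $u$ from $v$ (they lie in different components of $G-S$) with no proper subset doing so. A clique tree of a chordal graph $G$ is a tree $T$ whose vertices are the maximal cliques of $G$ such that for any two maximal cliques $Q,Q'$, every clique on the $T$-path from $Q$ to $Q'$ contains $Q\cap Q'$. For a chordal graph, the minimal vertex separators are exactly the sets $Q\cap Q'$ for edges $\{Q,Q'\}$ of a clique tree, and the multiset $\{Q\cap Q' : \{Q,Q'\}\in E(T)\}$ is the same for every clique tree; the multiplicity $\mu(S)$ of $S\in\mathbb S$ is the number of times $S$ occurs in this multiset. *)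

(* Defs.v *)
From HB Require Import structures.
From mathcomp Require Import all_boot all_order all_algebra all_field.
Set Implicit Arguments. Unset Strict Implicit. Unset Printing Implicit Defensive.
Import GRing.Theory Num.Theory.
Local Open Scope ring_scope.

Section Graphs.
Variable n : nat.
Implicit Types (e : rel 'I_n) (A S Q : {set 'I_n}) (u v : 'I_n).

Definition simple_graph e := symmetric e /\ irreflexive e.

Definition connected e := forall u v, connect e u v.

Definition induced_P4 e a b c d :=
  [/\ uniq [:: a; b; c; d], [&& e a b, e b c & e c d]
    & [&& ~~ e a c, ~~ e b d & ~~ e a d]].

Definition induced_C4 e a b c d :=
  [/\ uniq [:: a; b; c; d], [&& e a b, e b c, e c d & e d a]
    & ~~ e a c && ~~ e b d].

Definition quasi_threshold e :=
  forall a b c d, ~ induced_P4 e a b c d /\ ~ induced_C4 e a b c d.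

Definition deg e v := #|[set u | e v u]|.

Definition is_clique e A : bool :=
  [forall x in A, forall y in A, (x != y) ==> e x y].

Definition maximal_clique e Q : bool :=
  is_clique e Q && [forall A : {set 'I_n}, (is_clique e A && (Q \subset A)) ==> (A == Q)].

Definition simplicial e v : bool := is_clique e [set u | e v u].

Definition Simp e Q := [set v in Q | simplicial e v].

Definition separates e S u v : bool :=
  [&& u \notin S, v \notin S &
      ~~ connect [rel x y | [&& e x y, x \notin S & y \notin S]] u v].

Definition minimal_vertex_separator e S : bool :=
  [exists u, exists v, [&& u != v, ~~ e u v, separates e S u v &
                 [forall S' : {set 'I_n}, (S' \proper S) ==> ~~ separates e S' u v]]].

Definition maxcliques e : {set {set 'I_n}} := [set Q | maximal_clique e Q].
Definition minseps e : {set {set 'I_n}} :=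
  [set S | minimal_vertex_separator e S].

(* A candidate clique tree is given by its list of (undirected) edges. *)
Definition tree_rel (E : seq ({set 'I_n} * {set 'I_n})) : rel {set 'I_n} :=
  fun Q R => ((Q, R) \in E) || ((R, Q) \in E).

Definition is_clique_tree e (E : seq ({set 'I_n} * {set 'I_n})) :=
  [/\
      forall p, p \in E -> [/\ p.1 \in maxcliques e, p.2 \in maxcliques e & p.1 != p.2],
      uniq [seq [set p.1; p.2] | p <- E],
      (* a tree: connected with #vertices - 1 edges *)
      (size E = #|maxcliques e| - 1)%N,
      (forall Q R, Q \in maxcliques e -> R \in maxcliques e ->
         exists p, path (tree_rel E) Q p /\ last Q p = R) &
      (* clique intersection property along the (unique) tree path *)
      forall Q R p, Q \in maxcliques e -> R \in maxcliques e ->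
         path (tree_rel E) Q p -> last Q p = R -> uniq (Q :: p) ->
         all (fun X : {set 'I_n} => (Q :&: R) \subset X) (Q :: p)].

Definition mu (E : seq ({set 'I_n} * {set 'I_n})) S :=
  count (fun p => p.1 :&: p.2 == S) E.

Definition laplacian e : 'M[algC]_n :=
  \matrix_(i, j) (if i == j then (deg e i)%:R else - (e i j)%:R).

Definition eig_multiset e (E : seq ({set 'I_n} * {set 'I_n})) : seq nat :=
  [seq (deg e v).+1 | v <- enum 'I_n & ~~ simplicial e v]
  ++ flatten [seq nseq (#|Simp e Q| - 1)%N #|Q| | Q <- enum (maxcliques e)]
  ++ flatten [seq nseq (mu E X) #|X| | X <- enum (minseps e)].

End Graphs.

(* Main.v *)
(** In a quasi-threshold graph the closed neighbourhoods of adjacent vertices are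
    nested, so adjacency is comparability in a forest order. Let a(v) be the
    number of vertices strictly above v. Eliminating xI - L from the leaves
    upwards gives
      det (xI - L) = prod_v (x - d(v) - 1) / r(v),
      r(v) = (x - a(v) - 1) / (x - a(v)).
    Maximal cliques and their intersections are up-closed chains S, on which a
    takes the values 0, ..., |S| - 1, so x - |S| = x * prod_(v in S) r(v). A
    vertex v lying in k(v) maximal cliques lies in exactly k(v) - 1 edge
    intersections of a clique tree, and each maximal clique is the closed
    neighbourhood of each of its simplicial vertices. Hence in the product
    claimed for the spectrum the exponents of r(v) add up to
    (k(v) - 1) - k(v) = -1. Comparing at the points x = -1, -2, ... suffices, and
    there all denominators are nonzero. *)
Require Import Defs.
From HB Require Import structures.
From mathcomp Require Import all_boot all_order all_algebra all_field.
From mathcomp Require Import fingroup perm ring zify.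
Set Implicit Arguments. Unset Strict Implicit. Unset Printing Implicit Defensive.
Import GRing.Theory Num.Theory.
Local Open Scope ring_scope.

(** * Chains and telescoping in a forest order *)

Section ForestOrder.
Variables (T : finType) (lt : rel T).
Hypothesis lt_irr : irreflexive lt.
Hypothesis lt_trans : transitive lt.
Hypothesis lt_forest : forall v u w, lt v u -> lt v w -> u != w -> lt u w || lt w u.

(** With [lt v u] read as [u] above [v], [depth] counts ancestors and [height] counts
    descendants. *)
Definition depth v := #|[set u | lt v u]|.
Definition height v := #|[set u | lt u v]|.

Definition up_chain (S : {set T}) :=
  (forall u w, u \in S -> w \in S -> u != w -> lt u w || lt w u) /\
  (forall v u, v \in S -> lt v u -> u \in S).

Lemma depth_lt v u : lt v u -> (depth u < depth v)%N.
Proof.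
move=> vu; apply: proper_card; apply/properP; split.
  by apply/subsetP=> w; rewrite !inE; apply: lt_trans.
by exists u; rewrite !inE ?lt_irr.
Qed.

Lemma depth_inj_chain S : up_chain S -> {in S &, injective depth}.
Proof.
move=> [chS _] u w uS wS duw; apply/eqP; apply: contraT => neq.
by case/orP: (chS u w uS wS neq) => /depth_lt; rewrite duw ltnn.
Qed.

(** The ancestors of a member of [S] are other members of [S], so depths stay below [#|S|]; being
    distinct, they take each such value once. *)
Lemma perm_depth_chain S : up_chain S ->
  perm_eq [seq depth v | v <- enum S] (iota 0 #|S|).
Proof.
move=> chS; have Hu : uniq [seq depth v | v <- enum S].
  rewrite map_inj_in_uniq ?enum_uniq // => u w.
  by rewrite !mem_enum; apply: depth_inj_chain.
have Hs : {subset [seq depth v | v <- enum S] <= iota 0 #|S|}.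
  move=> _ /mapP[v + ->]; rewrite mem_enum mem_iota add0n /= => vS.
  apply: proper_card; apply/properP; split.
    by apply/subsetP=> w; rewrite inE; apply: chS.2.
  by exists v; rewrite ?inE ?lt_irr.
apply: uniq_perm => //; first exact: iota_uniq.
by apply: (uniq_min_size Hu Hs _).2; rewrite size_map size_iota -cardE.
Qed.

Lemma big_chain (R : Type) (idx : R) (op : Monoid.com_law idx) (g : nat -> R) S :
  up_chain S ->
  \big[op/idx]_(v in S) g (depth v) = \big[op/idx]_(0 <= i < #|S|) g i.
Proof.
move=> chS; rewrite -big_enum /= -(big_map depth xpredT g).
by rewrite (perm_big _ (perm_depth_chain chS)) /index_iota subn0.
Qed.

Lemma up_chain_above v : up_chain [set u | lt v u].
Proof.
split=> [u w|u w]; rewrite !inE; first exact: lt_forest.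
by move=> vu; apply: lt_trans.
Qed.

Lemma up_chain_aboveU v : up_chain (v |: [set u | lt v u]).
Proof.
split=> [u w|u w]; rewrite !inE.
  case/orP=> [/eqP->|vu] /orP[/eqP->|vw] //; rewrite ?eqxx ?vu ?vw ?orbT //.
  exact: lt_forest vu vw.
by case/orP=> [/eqP->->|vu uw]; rewrite ?orbT // (lt_trans vu uw) orbT.
Qed.

Lemma card_aboveU v : #|v |: [set u | lt v u]| = (depth v).+1.
Proof. by rewrite cardsU1 inE lt_irr. Qed.

Variables (F : fieldType) (x : F).
Hypothesis x_gen : forall k : nat, x != k%:R.

(** The nonzero off-diagonal entry of the elimination matrix in the row of a vertex of depth [j]. *)
Let g (j : nat) : F := (x - j%:R)^-1.

Lemma sub_nat_neq0 (k : nat) : x - k%:R != 0.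
Proof. by rewrite subr_eq0. Qed.

Lemma sum_chain S : up_chain S ->
  \sum_(v in S) (g (depth v) - g (depth v).+1) = g 0%N - g #|S|.
Proof.
move=> chS; rewrite (big_chain _ (fun j => g j - g j.+1)) //=.
rewrite -[RHS]opprB -telescope_sumr // -sumrN.
by apply: eq_bigr => i _; rewrite opprB.
Qed.

Lemma prod_chain S : up_chain S ->
  x - #|S|%:R =
  x * \prod_(v in S) ((x - (depth v).+1%:R) / (x - (depth v)%:R)).
Proof.
move=> chS; rewrite (big_chain _ (fun j => (x - j.+1%:R) / (x - j%:R))) //=.
elim: #|S| => [|m IH]; first by rewrite big_nil mulr1 subr0.
by rewrite big_nat_recr //= mulrA -IH mulrCA divff ?sub_nat_neq0 // mulr1.
Qed.

(* The pivot reached at [v] when the matrix [xI - L] is eliminated upwards. *)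
Definition pivot v : F :=
  (x - (depth v)%:R) * (x - (depth v + height v).+1%:R) / (x - (depth v).+1%:R).

Lemma pivot_step v : pivot v * g (depth v) ^+ 2 =
  g (depth v) + (height v)%:R * (g (depth v) - g (depth v).+1).
Proof.
have h0 := sub_nat_neq0 (depth v); have h1 := sub_nat_neq0 (depth v).+1.
rewrite -natr1 in h1; rewrite /pivot /g -!natr1 natrD; field.
by rewrite h0 h1.
Qed.

(* By [pivot_step] the sum is over pairs [w <= v < u]; for fixed [w] it
   telescopes along the chain from [w] up to [u]. *)
Lemma sum_below u :
  \sum_(v | lt v u) pivot v * g (depth v) ^+ 2 = (height u)%:R * g (depth u).+1.
Proof.
under eq_bigr => v _ do rewrite pivot_step.
rewrite big_split /=.
have -> : \sum_(v | lt v u) (height v)%:R * (g (depth v) - g (depth v).+1) =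
  \sum_(w | lt w u) \sum_(v | lt w v && lt v u) (g (depth v) - g (depth v).+1).
  rewrite [RHS](exchange_big_dep (fun v => lt v u)) /=; last by move=> w v _ /andP[].
  apply: eq_bigr => v vu; rewrite mulr_natl /height.
  rewrite -sumr_const; apply: eq_bigl => w; rewrite inE.
  by apply/idP/andP => [wv|[_ /andP[]]//]; rewrite wv vu (lt_trans wv vu).
rewrite -big_split /=.
rewrite mulr_natl /height -sumr_const.
apply: eq_big => [w|w wu]; first by rewrite inE.
have := sum_chain (up_chain_above w).
rewrite (bigID (fun v => lt v u)) /=.
(* The ancestors of [w] not below [u] are [u] and its ancestors, a full chain, so their sum
   telescopes from depth 0. *)
have -> : \sum_(v in [set v | lt w v] | ~~ lt v u) (g (depth v) - g (depth v).+1) =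
   g 0%N - g (depth u).+1.
  rewrite -card_aboveU -(sum_chain (up_chain_aboveU u)).
  apply: eq_bigl => v; rewrite !inE; apply/andP/orP => [[wv nvu]|].
    case: (eqVneq v u) => [->|neq]; [by left|right].
    by have := lt_forest wv wu neq; rewrite (negbTE nvu).
  case=> [/eqP->|uv]; first by rewrite wu lt_irr.
  rewrite (lt_trans wu uv); split=> //; apply/negP => vu.
  by have := lt_trans uv vu; rewrite lt_irr.
rewrite -/(depth w).
have -> : \sum_(v in [set v | lt w v] | lt v u) (g (depth v) - g (depth v).+1) =
  \sum_(v | lt w v && lt v u) (g (depth v) - g (depth v).+1).
  by apply: eq_bigl => v; rewrite !inE.
set s := \sum_(_ | _) _ => Hs.
have -> : s = (g 0%N - g (depth w)) - (g 0%N - g (depth u).+1) by rewrite -Hs addrK.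
by ring.
Qed.

End ForestOrder.

(** * Determinant of the comparability matrix *)

Section ForestDet.
Variables (n : nat) (lt : rel 'I_n).
Hypothesis lt_irr : irreflexive lt.
Hypothesis lt_trans : transitive lt.
Hypothesis lt_forest : forall v u w, lt v u -> lt v w -> u != w -> lt u w || lt w u.

(** A permutation with nonzero contribution sends each vertex to itself or to an ancestor, so it
    increases no depth. The sum of all depths is invariant, hence no depth drops and no vertex
    moves. *)
Lemma det_forest_unitriangular (R : comPzRingType) (B : 'M[R]_n) :
  (forall v, B v v = 1) -> (forall v u, v != u -> ~~ lt v u -> B v u = 0) ->
  \det B = 1.
Proof.
move=> B1 B0; rewrite /determinant (bigD1 (1%g : 'S_n)) //= [X in _ + X]big1 ?addr0.
  by rewrite odd_perm1 expr0 mul1r big1 // => i _; rewrite perm1.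
move=> s s1; suff /existsP[v /andP[v1 v2]] : [exists v, (v != s v) && ~~ lt v (s v)].
  by rewrite (bigD1 v) //= B0 // mul0r mulr0.
apply: contraNT s1 => /existsPn H; apply/eqP/permP=> v; rewrite perm1.
have Hle w : (depth lt (s w) <= depth lt w ?= iff (s w == w))%N.
  have := H w; rewrite negb_and !negbK eq_sym.
  case: (eqVneq (s w) w) => [->|neq] /= => [_|/(depth_lt lt_irr lt_trans) lts].
    exact: leqif_refl.
  by split; [apply: ltnW | rewrite ltn_eqF].
have := (@leqif_sum _ xpredT (fun w => s w == w) _ _ (fun w _ => Hle w)).
have <- : (\sum_w depth lt (s w) = \sum_w depth lt w)%N.
  by rewrite [RHS](reindex_inj (@perm_inj _ s)).
by case=> _; rewrite eqxx => /esym/forallP/(_ v)/eqP.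
Qed.

Variables (F : fieldType) (x : F).
Hypothesis x_gen : forall k : nat, x != k%:R.

Let g (j : nat) : F := (x - j%:R)^-1.

(** This is xI - L for the comparability graph of [lt], in which ancestors and descendants together
    make up the degree. *)
Definition comparability_mx : 'M[F]_n := \matrix_(u, w)
  if u == w then x - (depth lt u + height lt u)%:R else (lt u w || lt w u)%:R.

Lemma det_comparability_mx :
  \det comparability_mx = \prod_v pivot lt x v.
Proof.
(* Gaussian elimination from the leaves upwards gives M = B^T D B. *)
pose B : 'M[F]_n := \matrix_(v, u)
  if v == u then 1 else if lt v u then g (depth lt v) else 0.
have detB : \det B = 1.
  by apply: det_forest_unitriangular => [v|v u /negbTE h /negbTE h'];
     rewrite mxE ?eqxx // h h'.
pose D := diag_mx (\row_v pivot lt x v).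
suff -> : comparability_mx = B^T *m D *m B.
  rewrite !det_mulmx det_tr detB mul1r mulr1 det_diag.
  by apply: eq_bigr => v _; rewrite mxE.
have entry u w : (B^T *m D *m B) u w = \sum_v B v u * pivot lt x v * B v w.
  by rewrite mxE; apply: eq_bigr => v _; rewrite mul_mx_diag !mxE.
have Bsym u w : (B^T *m D *m B) u w = (B^T *m D *m B) w u.
  by rewrite !entry; apply: eq_bigr => v _; rewrite mulrC [B v u * _]mulrC mulrA.
have Bvv v : B v v = 1 by rewrite mxE eqxx.
have Blt v u : lt v u -> B v u = g (depth lt v).
  by move=> vu; rewrite mxE vu; case: eqP vu => // ->; rewrite lt_irr.
have B0 v u : v != u -> ~~ lt v u -> B v u = 0.
  by rewrite mxE => /negbTE-> /negbTE->.
(* Column [u] of [B] is supported on [u] and its descendants. *)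
have split_entry u w : (B^T *m D *m B) u w =
    pivot lt x u * B u w + \sum_(v | lt v u) pivot lt x v * g (depth lt v) * B v w.
  rewrite entry (bigD1 u) //= Bvv mul1r; congr (_ + _).
  rewrite (bigID (fun v => lt v u)) /= [X in _ + X]big1 ?addr0; last first.
    by move=> v /andP[h1 h2]; rewrite B0 // !mul0r.
  apply: eq_big => [v|v /andP[_ vu]].
    by rewrite andb_idl // => vu; case: eqP vu => // ->; rewrite lt_irr.
  by rewrite (Blt v u) // [g _ * _]mulrC.
have h0 u := sub_nat_neq0 x_gen (depth lt u).
have h1 u : x - ((depth lt u)%:R + 1) != 0.
  by rewrite natr1 (sub_nat_neq0 x_gen).
(* With a and h the depth and height of [u], the entry is (x - a - h - 1) / (x - a - 1) + h / (x - a
   - 1). *)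
have lt_entry u w : lt u w -> (B^T *m D *m B) u w = 1.
  move=> uw; rewrite split_entry Blt //.
  under eq_bigr => v vu do rewrite (Blt v w (lt_trans vu uw)) -mulrA -expr2.
  rewrite (sum_below lt_irr lt_trans lt_forest x_gen) /pivot /g -!natr1 natrD.
  by field; rewrite h0 h1.
apply/matrixP=> u w; rewrite [LHS]mxE; case: eqVneq => [<-|neq].
  rewrite split_entry Bvv mulr1.
  under eq_bigr => v vu do rewrite Blt // -mulrA -expr2.
  rewrite (sum_below lt_irr lt_trans lt_forest x_gen) /pivot -!natr1 natrD.
  by field; rewrite h1.
case uw: (lt u w); first by rewrite lt_entry.
case wu: (lt w u); first by rewrite Bsym lt_entry.
(* Incomparable vertices have no common descendant, so every term vanishes. *)
rewrite split_entry B0 ?uw // mulr0 add0r big1 // => v vu.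
rewrite B0 ?mulr0 //; first by apply: contraFneq wu => <-.
by apply: contraFN (orbF false) => vw; have := lt_forest vu vw neq; rewrite uw wu.
Qed.

End ForestDet.

(** * The forest order of a quasi-threshold graph *)

Section QuasiThreshold.
Variables (n : nat) (e : rel 'I_n).
Hypotheses (He : simple_graph e) (Hqt : quasi_threshold e).
Implicit Types (u v w : 'I_n) (Q R S : {set 'I_n}).

Let e_sym : symmetric e := He.1.
Let e_irr : irreflexive e := He.2.

Definition closed_nbhd v := v |: [set u | e v u].

(* On an edge of a quasi-threshold graph this is inclusion of closed
   neighbourhoods, with twins ordered by their index. *)
Definition nbhd_lt : rel 'I_n := fun v u =>
  e v u && ((deg e v < deg e u) || (deg e v == deg e u) && (v < u))%N.

Lemma in_closed_nbhd v u : (u \in closed_nbhd v) = (u == v) || e v u.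
Proof. by rewrite !inE. Qed.

Lemma card_closed_nbhd v : #|closed_nbhd v| = (deg e v).+1.
Proof. by rewrite cardsU1 inE e_irr. Qed.

(* A failure of inclusion yields y in N[v] \ N[u] and z in N[u] \ N[v], and
   then y, v, u, z induce a P4 or a C4. *)
Lemma closed_nbhd_sub v u :
  e v u -> (deg e v <= deg e u)%N -> closed_nbhd v \subset closed_nbhd u.
Proof.
move=> vu led; apply/negPn/negP => nsub.
have [y yv yu] := subsetPn nsub.
have [z zu zv] : exists2 z, z \in closed_nbhd u & z \notin closed_nbhd v.
  apply/subsetPn/negP => sub; case/negP: nsub.
  by have /eqP-> : closed_nbhd u == closed_nbhd v
    by rewrite eqEcard sub !card_closed_nbhd ltnS.
move: yv yu zu zv; rewrite !in_closed_nbhd !negb_or.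
case/orP=> [/eqP->|vy]; first by rewrite e_sym vu andbF.
case/andP=> yu uy; case/orP=> [/eqP->|uz]; first by rewrite vu andbF.
case/andP=> zv vz.
have neq a b : e a b -> a != b by apply: contraTneq => ->; rewrite e_irr.
have yz : y != z by apply: contraTneq vy => ->.
have [h4 h4'] := Hqt y v u z.
have yv : e y v by rewrite e_sym.
have nyu : ~~ e y u by rewrite e_sym.
have U : uniq [:: y; v; u; z].
  by rewrite /= !inE !negb_or (neq y v yv) (neq v u vu) (neq u z uz) yu yz (eq_sym v) zv.
case yez: (e y z); last by case: h4; split; rewrite ?yv ?vu ?uz ?nyu ?vz ?yez.
by case: h4'; split; rewrite ?yv ?vu ?uz ?(e_sym z) ?yez ?nyu ?vz.
Qed.

Lemma nbhd_lt_sub v u : nbhd_lt v u -> closed_nbhd v \subset closed_nbhd u.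
Proof.
case/andP=> vu h; apply: closed_nbhd_sub => //.
by case/orP: h => [/ltnW//|/andP[/eqP-> _]].
Qed.

Lemma adj_nbhd_lt u w : e u w = nbhd_lt u w || nbhd_lt w u.
Proof.
rewrite /nbhd_lt (e_sym w); case uw: (e u w) => //=.
have : val u != val w by rewrite val_eqE; apply: contraTneq uw => ->; rewrite e_irr.
by move=> /=; lia.
Qed.

Lemma nbhd_lt_irr : irreflexive nbhd_lt.
Proof. by move=> v; rewrite /nbhd_lt e_irr. Qed.

Lemma nbhd_lt_adj v u : nbhd_lt v u -> e v u.
Proof. by case/andP. Qed.

(** Nesting puts [v] in the closed neighbourhood of [w]; equality is excluded by comparing degrees
    and indices. *)
Lemma nbhd_lt_trans : transitive nbhd_lt.
Proof.
move=> u v w vu uw; apply/andP; split; last first.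
  by move: vu uw; rewrite /nbhd_lt => /andP[_ +] /andP[_ +]; lia.
have : v \in closed_nbhd w.
  apply: (subsetP (nbhd_lt_sub uw)); rewrite in_closed_nbhd e_sym.
  by rewrite (nbhd_lt_adj vu) orbT.
rewrite in_closed_nbhd e_sym => /orP[/eqP vw|//].
by move: vu uw; rewrite vw /nbhd_lt => /andP[_ +] /andP[_ +]; lia.
Qed.

Lemma nbhd_lt_forest v u w :
  nbhd_lt v u -> nbhd_lt v w -> u != w -> nbhd_lt u w || nbhd_lt w u.
Proof.
move=> vu vw uw; rewrite -adj_nbhd_lt e_sym.
have : u \in closed_nbhd w.
  by apply: (subsetP (nbhd_lt_sub vw)); rewrite in_closed_nbhd (nbhd_lt_adj vu) orbT.
by rewrite in_closed_nbhd (negbTE uw).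
Qed.

Lemma deg_depth_height v : deg e v = (depth nbhd_lt v + height nbhd_lt v)%N.
Proof.
rewrite /deg /depth /height -cardsUI.
rewrite [X in (_ + X)%N](_ : _ = 0%N) ?addn0.
  by congr #|pred_of_set _|; apply/setP=> u; rewrite !inE adj_nbhd_lt.
apply/eqP; rewrite cards_eq0 -subset0; apply/subsetP=> u; rewrite !inE.
by case/andP=> vu uv; have := nbhd_lt_trans vu uv; rewrite nbhd_lt_irr.
Qed.

(** * Maximal cliques as up-closed chains *)

Lemma cliqueP Q :
  reflect (forall x y, x \in Q -> y \in Q -> x != y -> e x y) (is_clique e Q).
Proof.
apply: (iffP forall_inP) => [H x y xQ yQ xy|H x xQ].
  by have /forall_inP/(_ y yQ)/implyP/(_ xy) := H x xQ.
by apply/forall_inP=> y yQ; apply/implyP; apply: H.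
Qed.

Lemma maximal_cliqueP Q : maximal_clique e Q ->
  is_clique e Q /\ (forall A, is_clique e A -> Q \subset A -> A = Q).
Proof.
case/andP=> cQ /forallP H; split=> // A cA QA.
by have /implyP/(_ _)/eqP := H A; apply; rewrite cA QA.
Qed.

(** Otherwise [y |: Q] would be a larger clique. *)
Lemma maximal_clique_mem Q y : maximal_clique e Q ->
  (forall x, x \in Q -> y \in closed_nbhd x) -> y \in Q.
Proof.
move=> /maximal_cliqueP[cQ mQ] H.
rewrite -(mQ (y |: Q)) ?setU11 ?subsetUr //; apply/cliqueP=> a b.
rewrite !inE => /orP[/eqP->|aQ] /orP[/eqP->|bQ] ab; rewrite ?eqxx // in ab *.
- by have := H b bQ; rewrite in_closed_nbhd (negbTE ab) e_sym.
- by have := H a aQ; rewrite in_closed_nbhd eq_sym (negbTE ab).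
- exact: (cliqueP _ cQ).
Qed.

Lemma clique_sub_closed_nbhd Q v : is_clique e Q -> v \in Q -> Q \subset closed_nbhd v.
Proof.
move=> /cliqueP cQ vQ; apply/subsetP=> u uQ; rewrite in_closed_nbhd.
by case: eqVneq => //= uv; apply: cQ => //; rewrite eq_sym.
Qed.

(** If [u] lies above a member [v], then [Q] is inside the closed neighbourhood of [v], hence of
    [u], and maximality puts [u] in [Q]. *)
Lemma maximal_clique_up_chain Q : maximal_clique e Q -> up_chain nbhd_lt Q.
Proof.
move=> mQ; have [cQ _] := maximal_cliqueP mQ; split=> [u w uQ wQ uw|v u vQ vu].
  by rewrite -adj_nbhd_lt; apply: (cliqueP _ cQ).
apply: (maximal_clique_mem mQ) => x xQ.
have : x \in closed_nbhd u.
  by apply: (subsetP (nbhd_lt_sub vu)); apply: (subsetP (clique_sub_closed_nbhd cQ vQ)).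
by rewrite !in_closed_nbhd eq_sym e_sym.
Qed.

Lemma up_chainI Q R : up_chain nbhd_lt Q -> up_chain nbhd_lt R -> up_chain nbhd_lt (Q :&: R).
Proof.
move=> [c1 u1] [_ u2]; split=> [u w /setIP[uQ _] /setIP[wQ _]|v u /setIP[vQ vR] vu].
  exact: c1.
by apply/setIP; split; [apply: u1 vu | apply: u2 vu].
Qed.

(** * Simplicial and lowest vertices of maximal cliques *)

Lemma simplicial_closed_nbhd v : simplicial e v = is_clique e (closed_nbhd v).
Proof.
apply/cliqueP/cliqueP => H a b; last first.
  by rewrite !inE => va vb ab; apply: H; rewrite // in_closed_nbhd (va, vb) orbT.
rewrite !in_closed_nbhd => /orP[/eqP->|va] /orP[/eqP->|vb] ab //.
- by rewrite eqxx in ab.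
- by rewrite e_sym.
- by apply: H; rewrite ?inE.
Qed.

Lemma simplicial_maximal_clique v : simplicial e v -> maximal_clique e (closed_nbhd v).
Proof.
rewrite simplicial_closed_nbhd => cv; rewrite /maximal_clique cv /=.
apply/forallP=> A; apply/implyP=> /andP[cA vA]; rewrite eqEsubset vA andbT.
by apply: clique_sub_closed_nbhd => //; apply: (subsetP vA); apply: setU11.
Qed.

(** The closed neighbourhood of a simplicial vertex is a clique containing every clique through it,
    so it is the only maximal one there. *)
Lemma mem_Simp Q v : maximal_clique e Q ->
  (v \in Simp e Q) = simplicial e v && (closed_nbhd v == Q).
Proof.
move=> mQ; have [cQ mxQ] := maximal_cliqueP mQ; rewrite inE andbC.
case sv: (simplicial e v) => //=; apply/idP/eqP => [vQ|<-]; last exact: setU11.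
by apply: mxQ; [rewrite -simplicial_closed_nbhd | apply: clique_sub_closed_nbhd].
Qed.

(** A member of least degree has its closed neighbourhood inside that of every other member. The
    bound on [n] makes [Q] nonempty: without vertices, the empty set is a maximal clique. *)
Lemma maximal_clique_bottom Q : (0 < n)%N -> maximal_clique e Q ->
  exists2 v, v \in Q & closed_nbhd v = Q.
Proof.
move=> n0 mQ; have [cQ _] := maximal_cliqueP mQ.
have [v0 v0Q] : exists v, v \in Q.
  apply/set0Pn; apply: contraTneq (mQ) => ->.
  apply/negP => m0; suff : Ordinal n0 \in set0 by rewrite inE.
  by apply: (maximal_clique_mem m0) => x; rewrite inE.
have [v vQ vmin] := arg_minnP (deg e) v0Q.
exists v => //; apply/eqP; rewrite eqEsubset clique_sub_closed_nbhd // andbT.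
apply/subsetP=> y yv; apply: (maximal_clique_mem mQ) => x xQ.
case: (eqVneq v x) => [<-//|vx].
apply: (subsetP (closed_nbhd_sub _ (vmin x xQ))) => //.
exact: (cliqueP _ cQ).
Qed.

Lemma maximal_clique_ex v : exists2 Q, maximal_clique e Q & v \in Q.
Proof.
have c1 : is_clique e [set v].
  by apply/cliqueP=> a b /set1P-> /set1P->; rewrite eqxx.
have [Q /maxsetP[cQ mQ] vQ] := maxset_exists (P := is_clique e) c1.
exists Q; last by rewrite sub1set in vQ.
by rewrite /maximal_clique cQ; apply/forallP=> A; apply/implyP=> /andP[cA QA]; rewrite (mQ A).
Qed.

(* Any two distinct maximal cliques meet in a minimal separator of their
   lowest vertices: without the common ancestors, a walk from the bottom of Q
   stays below some vertex of Q outside R. *)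
Lemma maximal_cliqueI_separator Q R : (0 < n)%N ->
  maximal_clique e Q -> maximal_clique e R -> Q != R -> Q :&: R \in minseps e.
Proof.
move=> n0 mQ mR QR; have [u uQ Eu] := maximal_clique_bottom n0 mQ.
have [v vR Ev] := maximal_clique_bottom n0 mR.
have [cQ mxQ] := maximal_cliqueP mQ; have [cR mxR] := maximal_cliqueP mR.
have uR : u \notin R.
  apply: contra QR => uR; rewrite eq_sym; apply/eqP/esym/mxR => //.
  by rewrite -Eu clique_sub_closed_nbhd.
have vQ : v \notin Q.
  apply: contra QR => vQ; apply/eqP/esym/mxQ => //.
  by rewrite -Ev clique_sub_closed_nbhd.
have [_ upQ] := maximal_clique_up_chain mQ; have [_ upR] := maximal_clique_up_chain mR.
rewrite inE; apply/existsP; exists u; apply/existsP; exists v; apply/and4P; split.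
- by apply: contraNneq uR => ->.
- by apply: contra vQ; rewrite -Eu in_closed_nbhd => ->; rewrite orbT.
- rewrite /separates !inE (negbTE uR) (negbTE vQ) andbF /=; apply/negP.
  pose P := [pred y | [exists t in Q :\: R, (y == t) || nbhd_lt y t]].
  set r := (X in connect X) => cuv.
  (* Only an upward step could leave [P]; it would land above a vertex of [Q], hence in [Q], and
     outside [R] because the intersection is deleted. *)
  have rP y z : r y z -> y \in P -> z \in P.
    case/and3P=> yz _ zS /exists_inP[t tQ yt]; apply/exists_inP.
    have [tQ1 tR] : t \in Q /\ t \notin R by case/setDP: tQ.
    have Hz : z \in Q -> exists2 t0, t0 \in Q :\: R & (z == t0) || nbhd_lt z t0.
      by move=> zQ; exists z; rewrite ?eqxx //; move: zS; rewrite !inE zQ andbT.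
    move: yz; rewrite adj_nbhd_lt => /orP[yz|zy]; last first.
      exists t => //; case/orP: yt => [/eqP<-|yt]; first by rewrite zy orbT.
      by rewrite (nbhd_lt_trans zy yt) orbT.
    case/orP: yt => [/eqP Et|yt]; first by apply/Hz/(upQ t); rewrite // -Et.
    case: (eqVneq z t) => [->|zt]; first by exists t; rewrite ?eqxx.
    case/orP: (nbhd_lt_forest yz yt zt) => h; last exact/Hz/(upQ t).
    by exists t; rewrite // h orbT.
  have : v \in P.
    case/connectP: cuv => p + ->.
    have : u \in P by apply/exists_inP; exists u; rewrite ?inE ?uR ?eqxx.
    elim: p u {uQ Eu uR} => [|z p IH] y //= yP /andP[yz pz].
    exact/IH/pz/(rP _ _ yz).
  (* A vertex on or above [v] lies in [R], as [R] is up-closed. *)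
  case/exists_inP=> t /setDP[tQ /negP tR] /orP[/eqP Et|vt]; apply: tR; first by rewrite -Et.
  exact: upR vt.
(* If [S'] omits a common vertex [s], the path u, s, v survives. *)
- apply/forallP=> S'; apply/implyP=> /properP[_ [s /setIP[sQ sR] sS']].
  rewrite /separates; apply/negP => /and3P[uS vS /negP]; apply.
  have us : e u s.
    apply: (cliqueP _ cQ) => //.
    by apply: contraNneq uR => ->.
  have sv : e s v.
    apply: (cliqueP _ cR) => //.
    by apply: contraNneq vQ => <-.
  apply: (@connect_trans _ _ s); apply: connect1 => /=.
    by rewrite us uS.
  by rewrite sv sS'.
Qed.

End QuasiThreshold.

(** * Counting the edges of a clique tree *)

Lemma count_ltn (T : eqType) (P1 P2 : pred T) (s : seq T) p :
  subpred P1 P2 -> p \in s -> P2 p -> ~~ P1 p -> (count P1 s < count P2 s)%N.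
Proof.
move=> sub ps p2 /negbTE p1; elim: s ps => //= a s IH; rewrite inE.
case/orP=> [/eqP<-|/IH h]; first by rewrite p1 p2 ltnS sub_count.
rewrite -addnS leq_add //; case h1: (P1 a) => //.
by rewrite (sub _ h1).
Qed.

Section TreeCount.
Variable (T : finType) (E : seq (T * T)).

Definition edge_rel : rel T := fun x y => ((x, y) \in E) || ((y, x) \in E).

(* Growing W one vertex at a time, each new vertex uses up a new edge. *)
Lemma connected_edge_bound (A W : {set T}) :
  (forall x y, x \in A -> y \in A ->
     exists p, [/\ path edge_rel x p, last x p = y & all (mem A) p]) ->
  W \subset A -> W != set0 ->
  (#|A :\: W| <= count (fun p => [&& p.1 \in A, p.2 \in A &
                               ~~ ((p.1 \in W) && (p.2 \in W))]) E)%N.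
Proof.
move=> cA; move Ek: #|A :\: W| => k; elim: k W Ek => [//|k IH] W Ek WA W0.
have [y yAW] : exists y, y \in A :\: W by apply/card_gt0P; rewrite Ek.
have [x xW] := set0Pn _ W0.
have [yA yW] : y \in A /\ y \notin W by case/setDP: yAW.
(* A path inside [A] from [W] to [y] has an edge leaving [W]. *)
have [a [b [aW bA bW ab]]] : exists a b, [/\ a \in W, b \in A, b \notin W & edge_rel a b].
  have [p [pp lp ap]] := cA x y (subsetP WA _ xW) yA.
  elim: p x xW pp lp ap => [|z p IHp] x xW /=.
    by move=> _ Exy; rewrite -Exy xW in yW.
  case/andP=> xz zp lp /andP[zA pA].
  case zW: (z \in W); first exact: (IHp z).
  by exists x, z; rewrite zW.
have aA := subsetP WA _ aW.
have {IH} := IH (b |: W); rewrite setDUr => IH.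
have /IH{}IH : #|(A :\: [set b]) :&: (A :\: W)| = k.
  have := cardsD1 b (A :\: W); rewrite Ek inE bW bA add1n => -[->].
  by congr #|pred_of_set _|; apply/setP=> z; rewrite !inE; case: (z == b); case: (z \in W); case: (z \in A).
have bWA : b |: W \subset A by rewrite subUset sub1set bA.
have bW0 : b |: W != set0 by apply/set0Pn; exists b; rewrite setU11.
have {}IH := IH bWA bW0.
apply: leq_ltn_trans IH _.
have [p pE Hp] : exists2 p, p \in E & p = (a, b) \/ p = (b, a).
  by case/orP: ab => pE; [exists (a, b) | exists (b, a)] => //; [left|right].
(* The edge between [a] and [b] is counted for [W] but no longer for [b |: W]. *)
apply: (count_ltn _ pE) => [q /and3P[-> -> h]||].
- by apply: contra h => /andP[h1 h2]; rewrite !inE h1 h2 !orbT.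
- by case: Hp => -> /=; rewrite aA bA (negbTE bW) ?andbF.
- by case: Hp => -> /=; rewrite !inE eqxx aW !orbT !andbF.
Qed.

End TreeCount.

Section CliqueTree.
Variables (n : nat) (e : rel 'I_n) (E : seq ({set 'I_n} * {set 'I_n})).
Hypothesis HE : is_clique_tree e E.

Lemma path_tree_maxcliques Q p : path (tree_rel E) Q p -> all (mem (maxcliques e)) p.
Proof.
have [Emax _ _ _ _] := HE; elim: p Q => //= R p IH Q /andP[QR /IH->]; rewrite andbT.
by case/orP: QR => /Emax[].
Qed.

(* The maximal cliques through v span a subtree, so it has one edge fewer than
   it has cliques. *)
Lemma clique_tree_count v Q0 : Q0 \in maxcliques e -> v \in Q0 ->
  count (fun p => v \in p.1 :&: p.2) E = (#|[set Q in maxcliques e | v \in Q]| - 1)%N.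
Proof.
move=> mQ0 vQ0; have [Emax _ sE cE iE] := HE.
set A := [set Q in maxcliques e | v \in Q].
have AE Q : (Q \in A) = (Q \in maxcliques e) && (v \in Q) by rewrite inE.
have Q0A : Q0 \in A by rewrite AE mQ0.
have A0 : A != set0 by apply/set0Pn; exists Q0.
have AM : A \subset maxcliques e by apply/subsetP=> Q; rewrite AE => /andP[].
have cM Q R : Q \in maxcliques e -> R \in maxcliques e ->
    exists p, [/\ path (edge_rel E) Q p, last Q p = R & all (mem (maxcliques e)) p].
  move=> mQ mR; have [p [pp lp]] := cE Q R mQ mR.
  by exists p; split=> //; apply: path_tree_maxcliques pp.
have cA Q R : Q \in A -> R \in A ->
    exists p, [/\ path (edge_rel E) Q p, last Q p = R & all (mem A) p].
  rewrite !AE => /andP[mQ vQ] /andP[mR vR].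
  have [p [pp lp]] := cE Q R mQ mR.
  (* The intersection property concerns simple paths; on such a path every clique contains [v]. *)
  case: (shortenP pp) lp => p' pp' up' _ lp'; exists p'; split=> //.
  have /= /andP[_ /allP h] := iE Q R p' mQ mR pp' lp' up'.
  apply/allP=> X Xp; rewrite /= AE; apply/andP; split.
    exact: (allP (path_tree_maxcliques pp')).
  by apply: (subsetP (h X Xp)); rewrite inE vQ.
have inA p : p \in E -> (v \in p.1 :&: p.2) = (p.1 \in A) && (p.2 \in A).
  by move=> /Emax[m1 m2 _]; rewrite inE !AE m1 m2.
have := connected_edge_bound cM AM A0.
(* Growing [A] to all m maximal cliques takes at least m - [#|A|] edges not inside [A]; growing one
   clique to [A] takes at least [#|A|] - 1 inside. There are m - 1 edges, so both bounds are
   attained. *)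
have := connected_edge_bound cA (W := [set Q0]).
rewrite sub1set Q0A => /(_ isT); rewrite -cards_eq0 cards1 => /(_ isT).
rewrite !cardsD (setIidPr AM) (setIidPr _) ?sub1set // cards1.
have kA : (0 < #|A|)%N by rewrite card_gt0.
have kM := subset_leq_card AM.
set c1 := count _ _; set c2 := count _ _; set c := count _ _.
have Ec : c = count (fun p => (p.1 \in A) && (p.2 \in A)) E by apply: eq_in_count.
have h1 : (c1 <= c)%N by rewrite Ec; apply: sub_count => p /and3P[/= -> ->].
have h2 : (c2 + c <= size E)%N.
  rewrite -(count_predC (fun p => (p.1 \in A) && (p.2 \in A)) E) -Ec addnC leq_add2l.
  by apply: sub_count => p /and3P[].
by lia.
Qed.

End CliqueTree.

(** * Regrouping products and comparing polynomials *)

Lemma prod_nseq_expr (R : comPzRingType) (m k : nat) (f : nat -> R) :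
  \prod_(i <- nseq m k) f i = f k ^+ m.
Proof. by elim: m => [|m IH]; rewrite ?big_nil // big_cons IH exprS. Qed.

(** Applied with [f] the intersection along a tree edge, this turns the multiplicities [mu] into a
    product over edges. *)
Lemma prod_expr_count (R : comPzRingType) (T : eqType) (U : finType) (f : T -> U)
    (A : {set U}) (g : U -> R) (s : seq T) :
  (forall p, p \in s -> f p \in A) ->
  \prod_(X in A) g X ^+ count (fun p => f p == X) s = \prod_(p <- s) g (f p).
Proof.
elim: s => [|p s IH] H; first by rewrite big_nil big1.
rewrite big_cons -IH => [|q qs]; last by rewrite H // inE qs orbT.
rewrite /=; under eq_bigr => X _ do rewrite exprD.
rewrite big_split /=; congr (_ * _).
rewrite (bigD1 (f p)) ?H ?mem_head //= eqxx expr1 big1 ?mulr1 // => X /andP[_ /negbTE h].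
by rewrite eq_sym h.
Qed.

Lemma prod_prod_mem (R : comPzRingType) (T : Type) (U : finType) (f : T -> {set U})
    (g : U -> R) (s : seq T) :
  \prod_(p <- s) \prod_(u in f p) g u = \prod_u g u ^+ count (fun p => u \in f p) s.
Proof.
elim: s => [|p s IH]; first by rewrite big_nil big1.
rewrite big_cons IH big_mkcond -big_split /=; apply: eq_bigr => u _.
by case: (u \in f p); rewrite ?exprS ?mul1r.
Qed.

Lemma horner_char_poly (R : comNzRingType) (n : nat) (A : 'M[R]_n) (x : R) :
  (char_poly A).[x] = \det (x%:M - A).
Proof.
rewrite /char_poly -horner_evalE -det_map_mx; congr (\det _).
by apply/matrixP=> i j; rewrite !mxE /= horner_evalE hornerD hornerN hornerMn hornerX hornerC.
Qed.

(** A nonzero difference would have too many roots. These sample points avoid the poles of the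
    pivots, which lie at natural numbers. *)
Lemma poly_eq_neg_nat (R : numDomainType) (p q : {poly R}) :
  (forall k : nat, p.[- k.+1%:R] = q.[- k.+1%:R]) -> p = q.
Proof.
move=> H; apply/eqP; rewrite -subr_eq0; apply: contraT => nz.
pose rs : seq R := [seq - k.+1%:R | k <- iota 0 (size (p - q))].
have := @max_poly_roots _ _ rs nz; rewrite size_map size_iota ltnn; apply.
  by apply/allP=> _ /mapP[k _ ->]; rewrite rootE !hornerE H subrr.
rewrite map_inj_uniq ?iota_uniq // => i j /oppr_inj/eqP.
by rewrite eqr_nat eqSS => /eqP.
Qed.

(** * Factoring the determinant over cliques and separators *)

Section Spectrum.
Variables (n : nat) (e : rel 'I_n) (E : seq ({set 'I_n} * {set 'I_n})).
Hypotheses (He : simple_graph e) (Hqt : quasi_threshold e) (HE : is_clique_tree e E).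
Hypothesis n_gt0 : (0 < n)%N.

Let lt := nbhd_lt e.
Let lt_irr := nbhd_lt_irr He.
Let lt_trans := nbhd_lt_trans He Hqt.
Let lt_forest := nbhd_lt_forest He Hqt.

Variable x : algC.
Hypothesis x_gen : forall k : nat, x != k%:R.

(** The ratio r(v), with [depth] as a(v). *)
Let rho v : algC := (x - (depth lt v).+1%:R) / (x - (depth lt v)%:R).

Lemma rho_neq0 v : rho v != 0.
Proof. by rewrite mulf_neq0 ?invr_eq0 ?sub_nat_neq0. Qed.

Lemma det_laplacian :
  \det (x%:M - laplacian e) = \prod_v ((x - (deg e v).+1%:R) / rho v).
Proof.
have -> : x%:M - laplacian e = comparability_mx lt x.
  apply/matrixP=> i j; rewrite !mxE; case: (eqVneq i j) => [->|_].
    by rewrite mulr1n (deg_depth_height He Hqt).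
  by rewrite mulr0n sub0r opprK (adj_nbhd_lt He).
rewrite det_comparability_mx //; apply: eq_bigr => v _.
by rewrite /pivot (deg_depth_height He Hqt) /rho invf_div mulrA [in RHS](mulrC (x - _)).
Qed.

Lemma maxcliqueP Q : Q \in maxcliques e -> maximal_clique e Q.
Proof. by rewrite inE. Qed.

Lemma prod_maxcliques :
  \prod_(Q in maxcliques e) (x - #|Q|%:R) =
  x ^+ #|maxcliques e| * \prod_v rho v ^+ #|[set Q in maxcliques e | v \in Q]|.
Proof.
transitivity (\prod_(Q in maxcliques e) (x * \prod_(v in Q) rho v)).
  apply: eq_bigr => Q /maxcliqueP mQ.
  exact/(prod_chain lt_irr lt_trans x_gen)/(maximal_clique_up_chain He Hqt).
rewrite big_split /= prodr_const; congr (_ * _).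
rewrite -big_enum /= (prod_prod_mem id); apply: eq_bigr => v _; congr (_ ^+ _).
rewrite -size_filter cardE; apply/perm_size/uniq_perm.
- exact/filter_uniq/enum_uniq.
- exact: enum_uniq.
by move=> Q; rewrite mem_filter !mem_enum !inE andbC.
Qed.

Lemma prod_tree_edges :
  \prod_(p <- E) (x - #|p.1 :&: p.2|%:R) =
  x ^+ size E * \prod_v rho v ^+ (#|[set Q in maxcliques e | v \in Q]| - 1)%N.
Proof.
have [Emax _ _ _ _] := HE.
transitivity (\prod_(p <- E) (x * \prod_(v in p.1 :&: p.2) rho v)).
  rewrite !big_seq; apply: eq_bigr => p /Emax[/maxcliqueP m1 /maxcliqueP m2 _].
  apply: (prod_chain lt_irr lt_trans x_gen).
  by apply: up_chainI; apply: maximal_clique_up_chain.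
rewrite big_split /= (prod_prod_mem (fun p => p.1 :&: p.2)).
rewrite big_const_seq count_predT iter_mulr_1; congr (_ * _).
apply: eq_bigr => v _; have [Q mQ vQ] := maximal_clique_ex e v.
by rewrite (clique_tree_count HE (Q0 := Q)) ?inE.
Qed.

Lemma prod_minseps :
  \prod_(S in minseps e) (x - #|S|%:R) ^+ mu E S = \prod_(p <- E) (x - #|p.1 :&: p.2|%:R).
Proof.
have [Emax _ _ _ _] := HE.
apply: (prod_expr_count (f := fun p => p.1 :&: p.2) (fun S : {set 'I_n} => x - #|S|%:R)).
by move=> p /Emax[/maxcliqueP m1 /maxcliqueP m2 ne]; apply: maximal_cliqueI_separator.
Qed.

(** Simplicial vertices are grouped by closed neighbourhood: the fibre over [Q] is [Simp e Q], and
    there the degree plus one is [#|Q|]. *)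
Lemma prod_simplicial :
  \prod_(v | simplicial e v) (x - (deg e v).+1%:R) =
  \prod_(Q in maxcliques e) (x - #|Q|%:R) ^+ #|Simp e Q|.
Proof.
rewrite (partition_big (closed_nbhd e) (mem (maxcliques e))) /=; last first.
  by move=> v sv; rewrite inE simplicial_maximal_clique.
apply: eq_bigr => Q /maxcliqueP mQ; rewrite -prodr_const.
apply: eq_big => [v|v /andP[_ /eqP<-]]; first by rewrite mem_Simp.
by rewrite card_closed_nbhd.
Qed.

(** This makes the truncated exponent [#|Simp e Q| - 1] exact. *)
Lemma Simp_gt0 Q : maximal_clique e Q -> (0 < #|Simp e Q|)%N.
Proof.
move=> mQ; have [v vQ Ev] := maximal_clique_bottom He Hqt n_gt0 mQ.
apply/card_gt0P; exists v; rewrite mem_Simp // Ev eqxx andbT.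
by rewrite simplicial_closed_nbhd // Ev; case/andP: mQ.
Qed.

Lemma det_laplacian_eig :
  \det (x%:M - laplacian e) = x * \prod_(m <- eig_multiset e E) (x - m%:R).
Proof.
have [_ _ sE _ _] := HE.
rewrite det_laplacian /eig_multiset !big_cat /= !big_flatten /= !big_map /=.
rewrite big_filter [X in _ * (X * _)]big_enum_cond /=.
under [X in _ * (_ * (X * _))]eq_bigr => Q _ do rewrite prod_nseq_expr.
under [X in _ * (_ * (_ * X))]eq_bigr => Q _ do rewrite prod_nseq_expr.
rewrite !big_enum /= prod_minseps prod_tree_edges.
have nzQ : \prod_(Q in maxcliques e) (x - #|Q|%:R) != 0.
  by apply/prodf_neq0 => Q _; apply: sub_nat_neq0.
(* One extra factor per clique completes the exponents of family (b), so the whole identity is later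
   multiplied by the clique product. *)
have H1 : \prod_(Q in maxcliques e) (x - #|Q|%:R) ^+ (#|Simp e Q| - 1) *
    \prod_(Q in maxcliques e) (x - #|Q|%:R) =
    \prod_(v | simplicial e v) (x - (deg e v).+1%:R).
  rewrite prod_simplicial -big_split /=; apply: eq_bigr => Q /maxcliqueP mQ.
  by rewrite -exprSr subn1 prednK ?Simp_gt0.
have M0 : (0 < #|maxcliques e|)%N.
  have [Q mQ _] := maximal_clique_ex e (Ordinal n_gt0).
  by apply/card_gt0P; exists Q; rewrite inE.
(* The cliques outnumber the tree edges by one, and so do the cliques through each [v]; this leaves
   one extra x and one extra [rho v]. *)
have H3 : \prod_(Q in maxcliques e) (x - #|Q|%:R) = x * x ^+ size E *
    (\prod_v rho v * \prod_v rho v ^+ (#|[set Q in maxcliques e | v \in Q]| - 1)).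
  rewrite prod_maxcliques -exprS sE subn1 prednK // -big_split /=; congr (_ * _).
  apply: eq_bigr => v _; rewrite -exprS subn1 prednK //.
  have [Q mQ vQ] := maximal_clique_ex e v.
  by apply/card_gt0P; exists Q; rewrite !inE mQ.
apply: (mulIf nzQ); rewrite prodf_div [X in X / _ * _](bigID (simplicial e)) /=.
have nzr : \prod_v rho v != 0 by apply/prodf_neq0 => v _; apply: rho_neq0.
rewrite -H1 {H1}; move: H3.
set NZ := \prod_(Q in _) _; set P2 := \prod_(Q in _) _.
set P1 := \prod_(v | ~~ _) _; set Pr := \prod_v _ in nzr *; set Pk := \prod_v _.
by move=> H3; rewrite H3; field.
Qed.

End Spectrum.

Theorem theorem7 (n : nat) (e : rel 'I_n)
    (He : simple_graph e) (Hconn : connected e) (Hqt : quasi_threshold e)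
    (E : seq ({set 'I_n} * {set 'I_n})) (HE : is_clique_tree e E) :
  char_poly (laplacian e) =
    'X ^+ (n - size (eig_multiset e E))%N *
    \prod_(m <- eig_multiset e E) ('X - (m%:R : algC)%:P).
Proof.
have [n0|n_gt0] := posnP n.
  subst n.
  (* Without vertices no clique has simplicial vertices, and the truncated 0 - 1 lists it zero
     times. *)
  have -> : eig_multiset e E = [::].
    rewrite /eig_multiset (size0nil (size_enum_ord 0)) /=.
    have -> : minseps e = set0.
      by apply/setP=> S; rewrite !inE; apply/existsP => -[[]].
    rewrite enum_set0 cats0 /=; elim: (enum _) => //= Q s ->.
    by rewrite (_ : Simp e Q = set0) ?cards0 //; apply/setP=> -[].
  by rewrite big_nil mulr1 subn0 expr0 /char_poly det_mx00.
set s := eig_multiset e E.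
have H : char_poly (laplacian e) = 'X * \prod_(m <- s) ('X - (m%:R : algC)%:P).
  apply: poly_eq_neg_nat => k; rewrite horner_char_poly (det_laplacian_eig He Hqt HE) //.
    rewrite hornerM hornerX horner_prod; congr (_ * _).
    by apply: eq_bigr => m _; rewrite hornerXsubC.
  by move=> j; rewrite -subr_eq0 -opprD oppr_eq0 -natrD pnatr_eq0.
rewrite H; congr (_ * _).
(* Comparing degrees gives [n = (size s).+1], so the power of ['X] in the statement is ['X]
   itself. *)
have := congr1 (fun p : {poly algC} => size p) H.
rewrite size_char_poly mulrC size_mulX ?monic_neq0 ?monic_prod_XsubC //.
rewrite size_prod_XsubC => -[->].
by rewrite subSn // subnn expr1.
Qed.
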